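(* Let $K\ge 3$, let $X_1,\dots,X_K$ be compact metric spaces, let $\mu_k\in\mathcal P(X_k)$ for $k=1,\dots,K$, and let $c:X_1\times\cdots\times X_K\to\mathbb R_+=[0,\infty)$ be continuous. Then there exists a maximizer $\boldsymbol f=(f_1,\dots,f_K)\in\mathcal F_c$ of the dual problem $\sup_{\boldsymbol f\in\mathcal F_c}J(\boldsymbol f)$ with $f_k\in c\text{-conj}(X_k)$ for each $k=1,\dots,K$. In particular, $$\mathsf{MOT}_c(\mu_1,\dots,\mu_K)=\max_{\boldsymbol f\in\mathcal F_c}J(\boldsymbol f)=\max_{\boldsymbol f\in\mathcal F_c\cap\prod_{k=1}^K c\text{-conj}(X_k)}J(\boldsymbol f).$$
   Context: $\mathcal P(X)$ is the set of Borel probability measures on $X$. $\Pi(\mu_1,\dots,\mu_K)$ is the set of $\pi\in\mathcal P(X_1\times\cdots\times X_K)$ whose $k$-th marginal is $\mu_k$ for every $k$, and $\mathsf{MOT}_c(\mu_1,\dots,\mu_K)=\inf_{\pi\in\Pi(\mu_1,\dots,\mu_K)}\int c\,d\pi$. For a family $\boldsymbol f=(f_1,\dots,f_K)$ with $f_k\in L^1(\mu_k)$, define $J(\boldsymbol f)=\sum_{k=1}^K\int_{X_k}f_k\,d\mu_k$. The admissible class $\mathcal F_c$ is the set of families $\boldsymbol f=(f_1,\dots,f_K)$ such that each $f_k:X_k\to\mathbb R$ is Borel with $f_k\in L^1(\mu_k)$, and $\sum_{k=1}^K f_k(x_k)\le c(x_1,\dots,x_K)$ for all $(x_1,\dots,x_K)$.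 The class $c\text{-conj}(X_k)$ is the set of functions $f_k:X_k\to\mathbb R$ for which there exist functions $h_l:X_l\to\mathbb R$, $l\ne k$, such that for all $x_k\in X_k$ $$f_k(x_k)=\inf_{(x_l)_{l\ne k}\in\prod_{l\neq k}X_l}\Big\{c(x_1,\dots,x_K)-\sum_{l\ne k}h_l(x_l)\Big\}.$$ *)

(* Defs.v *)
From HB Require Import structures.
From mathcomp Require Import all_boot all_order all_algebra.
From mathcomp Require Import all_classical all_reals all_analysis.

Set Implicit Arguments.
Unset Strict Implicit.
Unset Printing Implicit Defensive.

Import Order.TTheory GRing.Theory Num.Theory.
Import numFieldNormedType.Exports.

Local Open Scope classical_set_scope.
Local Open Scope ring_scope.

(* [measurableType] requires a designated point, hence the pointed variant of
   [metricType]; a space carrying a probability measure is nonempty anyway. *)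
#[short(type="pmetricType")]
HB.structure Definition PointedMetric (R : numDomainType) :=
  {M of Metric R M & Pointed M}.

Notation borel T := (g_sigma_algebraType (@open T)).

Notation prodX X := (prod_topology (fun k => X k : ptopologicalType)).

(* Plans are measures on the Borel sets of the product topology, rather than on
   the product sigma-algebra. *)
Definition couplings (R : realType) (K : nat) (X : 'I_K -> pmetricType R)
    (mu : forall k, probability (borel (X k)) R) :
    set (probability (borel (prodX X)) R) :=
  [set pi : probability (borel (prodX X)) R |
     forall k (A : set (borel (X k))), measurable A ->
       pushforward pi (fun x : borel (prodX X) => x k : borel (X k)) A = mu k A].

Definition MOT (R : realType) (K : nat) (X : 'I_K -> pmetricType R)
    (c : prodX X -> R) (mu : forall k, probability (borel (X k)) R) : \bar R :=
  ereal_inf [set (\int[pi]_x (c x)%:E)%E | pi in couplings mu].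

(* On admissible families every term is finite. *)
Definition J (R : realType) (K : nat) (X : 'I_K -> pmetricType R)
    (mu : forall k, probability (borel (X k)) R)
    (f : forall k, X k -> R) : \bar R :=
  (\sum_(k < K) \int[mu k]_x (f k x)%:E)%E.

Definition admissible (R : realType) (K : nat) (X : 'I_K -> pmetricType R)
    (c : prodX X -> R) (mu : forall k, probability (borel (X k)) R) :
    set (forall k, X k -> R) :=
  [set f : forall k, X k -> R |
     [/\ forall k, measurable_fun [set: borel (X k)] (f k),
         forall k, (mu k).-integrable [set: borel (X k)] (EFin \o f k) &
         forall x : prodX X, \sum_(k < K) f k (x k) <= c x]].

(* The component [h k] is not used.  The infimum is taken in [\bar R], so that
   the equation also says that it is finite. *)
Definition cconj (R : realType) (K : nat) (X : 'I_K -> pmetricType R)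
    (c : prodX X -> R) (k : 'I_K) : set (X k -> R) :=
  [set fk : X k -> R | exists h : forall l, X l -> R, forall xk : X k,
     (fk xk)%:E = ereal_inf [set (c x - \sum_(l < K | l != k) h l (x l))%:E |
                             x in [set x : prodX X | x k = xk]]].

Definition cconj_family (R : realType) (K : nat) (X : 'I_K -> pmetricType R)
    (c : prodX X -> R) : set (forall k, X k -> R) :=
  [set f : forall k, X k -> R | forall k, cconj c (f k)].

Definition is_max (R : realType) (A : set (\bar R)) (m : \bar R) : Prop :=
  A m /\ ubound A m.

(* Main.v *)
Require Import Defs.
From HB Require Import structures.
From mathcomp Require Import all_boot all_order all_algebra.
From mathcomp Require Import all_classical all_reals all_analysis.
From mathcomp Require Import finmap measurable_realfun ring lra.
Import Order.TTheory GRing.Theory Num.Theory.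
Import numFieldNormedType.Exports.

Set Implicit Arguments.
Unset Strict Implicit.
Unset Printing Implicit Defensive.

Local Open Scope classical_set_scope.
Local Open Scope ring_scope.

(** Dual maximizer.  Replacing the components of an admissible family one after
    the other by c-transforms, and adding constants of total sum 0, does not
    decrease [J] and produces a family with a uniform bound and with the modulus
    of continuity of [c].  Such families form a compact set for pointwise
    convergence, on which [J] is continuous because of the common modulus.

    Strong duality.  Let [D] be the dual maximum.  Cut each [X_k] into finitely
    many Borel cells on whose products [c] varies by at most e.  Step functions on
    the cells are admissible competitors, so the finite problem with the cell
    masses as marginals has dual value at most [D + e], and finite duality gives
    weights [p i] on the product cells with these marginals and cost at most
    [D + e].  Finite duality follows by minimizing the squared distance of
    (marginals, cost) to the target over the simplex: the first order condition
    at the minimizer is a dual certificate.  Spreading each [p i] over its cell by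
    any coupling of the conditioned [mu_k] yields a coupling of the [mu_k] of cost
    at most [D + 2e]. *)

(** * Boxes and Borel cells *)

Section box_topology.
Context (R : realType) (K : nat) (X : 'I_K -> pmetricType R).

(** Boxes play the role of the balls of a sup metric, [prodX X] being only a topological space. *)
Definition box (x : prodX X) (r : R) : set (prodX X) :=
  [set y | forall k, ball (x k) r (y k)].

(** The product topology is the coarsest one with continuous coordinates, so it suffices that the
    filter of sets containing a box around [x] refines the preimage of the neighbourhood filter of
    each [x k]. *)
Lemma nbhs_box (x : prodX X) (U : set (prodX X)) :
  nbhs x U -> exists2 r : R, 0 < r & box x r `<=` U.
Proof.
pose F : set_system (prodX X) := [set V | exists2 r : R, 0 < r & box x r `<=` V].
have FF : Filter F.
  split; first by exists 1.
  - move=> P Q [r r0 rP] [s s0 sQ]; exists (Num.min r s).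
      by rewrite lt_min r0.
    move=> y xy; split.
      by apply: rP => k; apply: le_ball (xy k); rewrite ge_min lexx.
    by apply: sQ => k; apply: le_ball (xy k); rewrite ge_min lexx orbT.
  - by move=> P Q PQ [r r0 rP]; exists r => // y /rP /PQ.
suff : F --> x by exact.
apply/cvg_sup => k A; rewrite (@nbhsE (initial_topology (fun f : prodX X => f k))).
move=> [B [[C oC <-] Cx] BA].
have /nbhs_ballP[r /= r0 rC] : nbhs (x k) C by exact: open_nbhs_nbhs.
by exists r => // y /(_ k) /rC Cy; exact: BA.
Qed.

Lemma box_nbhs (x : prodX X) (r : R) : 0 < r -> nbhs x (box x r).
Proof.
move=> r0.
apply: (@filter_forall _ _ (fun k (y : prodX X) => ball (x k) r (y k)) (nbhs x)) => k.
exact: (@proj_continuous _ _ k x _ (nbhsx_ballx (x k) r r0)).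
Qed.

Hypothesis compactX : forall k, compact [set: X k].

Lemma compact_prodX : compact [set: prodX X].
Proof.
have := tychonoff compactX; congr compact.
by apply/seteqP; split.
Qed.

(** Heine-Cantor: near covering compactness, applied along radii tending to 0 from the right, merges
    the local radii into one. *)
Lemma box_unif_continuous (c : prodX X -> R) (e : R) :
  continuous c -> 0 < e ->
  exists2 r : R, 0 < r & forall y z, box y r z -> `|c y - c z| <= e.
Proof.
move=> cc e0.
have e20 : 0 < e / 2 by rewrite divr_gt0.
have := @compact_near_coveringP (prodX X) setT.
move=> /iffLR/(_ compact_prodX) /(_ R (0 : R)^'+
  (fun r y => forall z, box y r z -> `|c y - c z| <= e)).
case.
- move=> x _.
  have /nbhs_box[r r0 rU] : nbhs x [set y | `|c x - c y| < e / 2].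
    exact: (cc x _ (nbhsx_ballx (c x) (e / 2) e20)).
  exists (box x (r / 2), [set s | 0 < s < r / 2]).
    split => /=; first by apply: box_nbhs; rewrite divr_gt0.
    near=> s; apply/andP; split; near: s; first exact: nbhs_right_gt.
    by apply: nbhs_right_lt; rewrite divr_gt0.
  move=> [y s]/= [xy /andP[s0 sr]] z yz.
  rewrite (le_trans (ler_distD (c x) _ _))// (splitr e) lerD//.
    rewrite distrC ltW//; apply: rU => k; apply: le_ball (xy k).
    by rewrite ler_pdivrMr// ler_peMr ?ltW// ltr1n.
  rewrite ltW//; apply: rU => k; rewrite (splitr r).
  by apply: ball_triangle (xy k) _; apply: le_ball (yz k); exact: ltW.
- move=> r /= r0 rP; exists (r / 2); first by rewrite divr_gt0.
  move=> y z; apply: rP => //=; last by rewrite divr_gt0.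
  by rewrite sub0r normrN gtr0_norm ?divr_gt0// ltr_pdivrMr// ltr_pMr// ltr1n.
Unshelve. all: by end_near. Qed.

End box_topology.

Section borel_cells.
Context (R : realType).

Lemma open_borel (T : ptopologicalType) (U : set T) :
  open U -> measurable (U : set (borel T)).
Proof. by move=> oU; exact: sub_sigma_algebra. Qed.

(** Labelling a point by the first open set containing it turns a cover into a partition, whose
    classes come from open sets by complements and finite intersections. *)
Lemma measurable_find (T : ptopologicalType) (I : Type) (U : I -> set T)
    (s : seq I) (j : nat) : (forall i, open (U i)) ->
  measurable ([set x | find (fun i => `[< U i x >]) s = j] : set (borel T)).
Proof.
move=> oU; elim: s j => [|i s IH] [|j] /=.
- by rewrite (_ : [set _ | _] = setT)//; apply/seteqP; split.
- by rewrite (_ : [set _ | _] = set0)//; apply/seteqP; split.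
- rewrite (_ : [set _ | _] = U i); first exact: open_borel.
  by apply/seteqP; split => x /=; case: asboolP.
- rewrite (_ : [set _ | _] =
      ~` U i `&` [set x | find (fun i => `[< U i x >]) s = j]).
    by apply: measurableI (IH j); apply: measurableC; exact: open_borel.
  by apply/seteqP; split => x /=; case: asboolP => // Ux; [case=> <-|case|case=> _ ->].
Qed.

Lemma compact_ball_cover (T : pmetricType R) (r : R) :
  compact [set: T] -> 0 < r ->
  exists s : seq T, forall x, has (fun t => `[< (ball t r)° x >]) s.
Proof.
move=> cT r0; move: cT; rewrite compact_cover.
move=> /(_ _ setT (fun t => (ball t r)°)).
case=> [t _|t _|D _ cover]; first exact: open_interior.
  by exists t => //; exact: nbhsx_ballx.
exists (enum_fset D) => x; apply/hasP.
by have [t /= tD tx] := cover x I; exists t => //; exact/asboolP.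
Qed.

(** The labels refer to finite covers by balls of radius [r / 2]: two points with the same label
    share a ball. *)
Lemma borel_cells (K : nat) (X : 'I_K -> pmetricType R) (r : R) :
  (forall k, compact [set: X k]) -> 0 < r ->
  exists N (q : forall k, X k -> 'I_N.+1),
    (forall k j, measurable ([set x | q k x = j] : set (borel (X k)))) /\
    (forall k x y, q k x = q k y -> ball x r y).
Proof.
move=> cX r0; have r20 : 0 < r / 2 by rewrite divr_gt0.
pose U k (t : X k) := (ball t (r / 2))°.
pose s k := sval (cid (compact_ball_cover (cX k) r20)).
have sP k : forall x, has (fun t => `[< U k t x >]) (s k).
  exact: (svalP (cid (compact_ball_cover (cX k) r20))).
(* The maximum gives all the spaces the same set of labels, so that a product cell is indexed by a
   function into ['I_N.+1]. *)
pose N := \max_k size (s k).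
pose i k x := find (fun t => `[< U k t x >]) (s k).
have iN k x : (i k x < N.+1)%N.
  by rewrite ltnS (leq_trans (find_size _ _))// /N (leq_bigmax k).
exists N, (fun k x => Ordinal (iN k x)); split => [k j|k x y /(congr1 val)/= xy].
  rewrite (_ : [set _ | _] = [set x | i k x = j]).
    by apply: measurable_find => t; exact: open_interior.
  by apply/seteqP; split => x /= => [<-//|xj]; exact: val_inj.
have /asboolP/interior_subset := nth_find (point : X k) (sP k x).
have /asboolP/interior_subset := nth_find (point : X k) (sP k y).
rewrite -/(i k x) -/(i k y) xy => /= yb /ball_sym xb.
by rewrite (splitr r); exact: ball_triangle xb yb.
Qed.

End borel_cells.

(** * Measurable maps into the product *)

Section borel_prodX.
Context (R : realType) (K : nat) (X : 'I_K -> pmetricType R).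

Lemma measurable_fun_borel d (T : measurableType d) (S : ptopologicalType)
    (f : T -> borel S) :
  (forall U : set S, open U -> measurable (f @^-1` U)) -> measurable_fun setT f.
Proof.
move=> mf; apply: (@measurability _ _ T (borel S) setT f (@open S)) => //.
by move=> _ [U oU <-]; rewrite setTI; exact: mf.
Qed.

Lemma measurable_proj k :
  measurable_fun [set: borel (prodX X)] (fun x => x k : borel (X k)).
Proof.
apply: measurable_fun_borel => U oU; apply: sub_sigma_algebra.
by apply: (@open_comp (prodX X)) => // x _; exact: proj_continuous.
Qed.

Lemma measurable_cylinder k (A : set (borel (X k))) : measurable A ->
  measurable [set x : borel (prodX X) | A (x k)].
Proof. by move=> mA; rewrite -[X in measurable X]setTI; exact: measurable_proj. Qed.

Lemma measurable_fun_open d (T : measurableType d) (f : T -> R) :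
  (forall U : set R, open U -> measurable (f @^-1` U)) -> measurable_fun setT f.
Proof.
move=> mf; apply: (@measurability _ _ T _ setT f _ (RGenOInfty.measurableE R)) => //.
move=> _ [_ [a ->] <-]; rewrite setTI; apply: mf.
exact: interval_open.
Qed.

Hypothesis compactX : forall k, compact [set: X k].

(* An open set of the product is the countable union of the product cells of
   size [1/n] that it contains. *)
Lemma measurable_fun_prodX d (T : measurableType d) (g : T -> borel (prodX X)) :
  (forall k, measurable_fun setT (fun t => g t k : borel (X k))) ->
  measurable_fun setT g.
Proof.
move=> mg; apply: (@measurability _ _ T (borel (prodX X)) setT g (@open (prodX X))) => //.
move=> _ [U oU <-]; rewrite setTI.
have r0 n : 0 < n.+1%:R^-1 :> R by [].
pose N n := sval (cid (borel_cells compactX (r0 n))).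
pose q n := sval (cid (svalP (cid (borel_cells compactX (r0 n))))).
have qP n : (forall k j, measurable ([set x | q n k x = j] : set (borel (X k)))) /\
    (forall k x y, q n k x = q n k y -> ball x n.+1%:R^-1 y).
  exact: (svalP (cid (svalP (cid (borel_cells compactX (r0 n)))))).
pose cell n (i : {ffun 'I_K -> 'I_(N n).+1}) :=
  [set x : prodX X | forall k, q n k (x k) = i k].
have -> : g @^-1` U = \bigcup_n \bigcup_(i in [set i | cell n i `<=` U])
    \bigcap_(k in setT) [set t | q n k (g t k) = i k].
  apply/seteqP; split => [t Ut|t [n _ [i iU ti]]]; last first.
    by apply: iU => k; exact: ti.
  have /nbhs_box[r r0' rU] : nbhs (g t) U by exact: open_nbhs_nbhs.
  have [n] := ltr_add_invr r0'; rewrite add0r => nr.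
  exists n => //; exists [ffun k => q n k (g t k)].
    move=> x xi; apply: rU => k; apply: le_ball (ltW nr) _ _.
    by apply: (qP n).2; rewrite xi ffunE.
  by move=> k _ /=; rewrite ffunE.
apply: bigcupT_measurable => n.
apply: fin_bigcup_measurable => // i _.
apply: fin_bigcap_measurable => // k _.
by have := mg k measurableT _ ((qP n).1 k (i k)); rewrite setTI.
Qed.

End borel_prodX.

Lemma measure1_probability (R : realType) d (T : measurableType d)
    (m : {measure set T -> \bar R}) : m [set: T] = 1%E ->
  exists P : probability T R, forall A, P A = m A.
Proof.
move=> m1; exists (mnormalize m (dirac point)) => A.
by rewrite /= /mnormalize m1 onee_eq0/= invr1 mule1.
Qed.

Lemma pushforward_probability (R : realType) d1 d2 (T1 : measurableType d1)
    (T2 : measurableType d2) (P : probability T1 R) (g : T1 -> T2) :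
  measurable_fun setT g ->
  exists Q : probability T2 R, forall A, Q A = P (g @^-1` A).
Proof.
move=> mg; pose mixin := isMeasurableFun.Build _ _ _ _ g mg.
pose G : {mfun T1 >-> T2} := HB.pack g mixin.
by exists (distribution P G).
Qed.

(** * Existence of couplings *)

Section coupling.
Context (R : realType) (K : nat) (X : 'I_K -> pmetricType R).
Hypothesis compactX : forall k, compact [set: X k].

(* The coordinates are resampled one at a time: step [n] pushes [pi x nu_n]
   forward under the map that overwrites the coordinate [n] of a point. *)
Lemma coupling_exists (nu : forall k, probability (borel (X k)) R) :
  couplings nu !=set0.
Proof.
suff /(_ K (leqnn K))[pi piP] : forall n, (n <= K)%N ->
    exists pi : probability (borel (prodX X)) R,
      forall k : 'I_K, (k < n)%N -> forall A : set (borel (X k)), measurable A ->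
      pi [set x : borel (prodX X) | A (x k)] = nu k A.
  by exists pi => k A mA; exact: piP.
elim=> [|n IH] nK; first by exists (dirac point).
have [pi piP] := IH (ltnW nK).
pose j : 'I_K := Ordinal nK.
have [m mE] : exists m : probability (borel (prodX X) * borel (X j))%type R,
    forall A B, measurable A -> measurable B -> m (A `*` B) = (pi A * nu j B)%E.
  by exists (pi \x nu j)%E => A B mA mB; exact: product_measure1E.
pose g (p : borel (prodX X) * borel (X j)) : borel (prodX X) := dfwith p.1 j p.2.
have mg : measurable_fun setT g.
  apply: measurable_fun_prodX => // k; have [->|kj] := eqVneq k j.
    rewrite (_ : (fun t => g t j) = snd); first exact: measurable_snd.
    by apply/funext => t; rewrite /g dfwithin.
  rewrite (_ : (fun t => g t k) = (fun x : borel (prodX X) => x k) \o fst).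
    by apply: measurableT_comp measurable_fst; exact: measurable_proj.
  by apply/funext => t; rewrite /g dfwithout// eq_sym.
have [Q QE] := pushforward_probability m mg.
exists Q => k; rewrite ltnS leq_eqVlt => kn A mA; rewrite QE.
have [kj|kj] := eqVneq k j.
  subst k.
  rewrite (_ : _ @^-1` _ = setT `*` A).
    by rewrite mE// probability_setT mul1e.
  by apply/seteqP; split => -[x y] /=; rewrite /g dfwithin// => -[].
rewrite (_ : _ @^-1` _ = [set x | A (x k)] `*` setT).
  rewrite mE// ?probability_setT ?mule1 ?piP//.
    by case/orP : kn => // /eqP kn; move: kj; rewrite -val_eqE/= kn eqxx.
  exact: measurable_cylinder.
by apply/seteqP; split => -[x y] /=; rewrite /g dfwithout 1?eq_sym// => -[].
Qed.

End coupling.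

(** * Finite duality *)

Lemma continuous_sum (R : realType) (T : topologicalType) (I : Type) (r : seq I)
    (F : I -> T -> R) :
  (forall i, continuous (F i)) -> continuous (fun x => \sum_(i <- r) F i x).
Proof.
move=> cF; elim: r => [|i r IH] x.
  by under eq_fun do rewrite big_nil; exact: cvg_cst.
by under eq_fun do rewrite big_cons; apply: cvgD; [exact: cF|exact: IH].
Qed.

Section finite_duality.
Context (R : realType) (I J : finType).

(** The bounds on [p i] make the first set a product of segments, compact for pointwise convergence
    by Tychonoff. *)
Definition simplex : set {ptws I -> R} :=
  [set p | forall i, p i \in `[0, 1]] `&` [set p | \sum_i p i = 1].

Lemma dot_continuous (a : I -> R) :
  continuous (fun p : {ptws I -> R} => \sum_i p i * a i).
Proof.
apply: continuous_sum => i p.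
apply: (@continuousM _ {ptws I -> R} (fun p => p i) (fun=> a i)).
  exact: (@proj_continuous _ (fun=> R) i p).
exact: cst_continuous.
Qed.

Lemma simplex_compact : compact simplex.
Proof.
apply: compact_closedI.
  have := @tychonoff I (fun=> R) (fun=> `[0, 1]%classic)
    (fun=> segment_compact (R := R) (a := 0) (b := 1)).
  by congr compact; apply/seteqP; split.
rewrite (_ : [set _ | _] = (fun p : {ptws I -> R} => \sum_i p i * 1) @^-1` [set 1]).
  apply: closed_comp; last exact: closed_eq.
  by move=> p _; exact: dot_continuous.
by apply/seteqP; split => p /= p1; rewrite -[RHS]p1; apply: eq_bigr => i _; rewrite mulr1.
Qed.

(** First order condition at an end point: if [a < 0], then [t = min(1, - a / q)] gives
    [2 * a + t * q <= a < 0]. The case [t = 1] shows that [q > 0]. *)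
Lemma quadratic_ge0 (a q : R) :
  (forall t, 0 < t <= 1 -> 0 <= 2 * t * a + t ^+ 2 * q) -> 0 <= a.
Proof.
move=> h; rewrite leNgt; apply/negP => a0.
have q0 : 0 < q by have := h 1; rewrite ltr01 lexx expr1n => /(_ isT); lra.
pose t := Num.min 1 (- a / q).
have t0 : 0 < t by rewrite lt_min ltr01 divr_gt0// oppr_gt0.
have tq : t * q <= - a by rewrite -ler_pdivlMr// ge_min lexx orbT.
have := h t; rewrite t0 ge_min lexx/= => /(_ isT).
rewrite (_ : _ + _ = t * (2 * a + t * q)); last by ring.
by rewrite pmulr_rge0//; lra.
Qed.

(** The left side is the squared distance from [u + h] to the nonpositive half-line, the right side
    its squared distance to the projection of [u] on that half-line. This replaces differentiating
    the squared positive part. *)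
Lemma max0_sqr_le (u h : R) :
  Num.max 0 (u + h) ^+ 2 <= (Num.max 0 u + h) ^+ 2.
Proof.
have := le_max 0 u 0; have := le_max u u 0.
by case: (leP 0 u); case: (leP 0 (u + h)) => *; nra.
Qed.

Variables (A : I -> J -> R) (b : J -> R) (c : I -> R) (D : R).

Let Ap (p : I -> R) j := \sum_i p i * A i j.
Let cp (p : I -> R) := \sum_i p i * c i.
(** The squared distance from the pair [Ap p], [cp p] to the product of the point [b] and the
    half-line below [D]. *)
Let phi (p : {ptws I -> R}) : R :=
  \sum_j (Ap p j - b j) ^+ 2 + (Num.max 0 (cp p - D)) ^+ 2.

Let phi_continuous : continuous phi.
Proof.
have cB (a : I -> R) (z : R) :
    continuous (fun p : {ptws I -> R} => \sum_i p i * a i - z).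
  move=> p; apply: (@continuousB _ R^o _
    (fun p : {ptws I -> R} => \sum_i p i * a i) (fun=> z)).
    exact: dot_continuous.
  exact: cst_continuous.
have csqr (f : {ptws I -> R} -> R) : continuous f -> continuous (fun p => f p ^+ 2).
  by move=> cf p; apply: (@continuousM _ _ f f); exact: cf.
move=> p; apply: (@continuousD _ R^o _
    (fun p : {ptws I -> R} => \sum_j (Ap p j - b j) ^+ 2)
    (fun p => Num.max 0 (cp p - D) ^+ 2)).
  apply: continuous_sum => j.
  by apply: csqr; exact: cB.
apply: (csqr (fun p => Num.max 0 (cp p - D))) => {}p.
have := @continuous_max R {ptws I -> R} (fun=> 0) (fun p => cp p - D) p.
by apply; [exact: cst_continuous|exact: cB].
Qed.

(** The segment from [p] to the vertex [i] of the simplex; optimality is tested only in these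
    directions. *)
Let towards (p : I -> R) i t : I -> R := fun k => (1 - t) * p k + t * (k == i)%:R.

Let dot_towards p i t (a : I -> R) :
  \sum_k towards p i t k * a k = \sum_k p k * a k + t * (a i - \sum_k p k * a k).
Proof.
have ai : \sum_k (k == i)%:R * a k = a i.
  by rewrite (bigD1 i)//= eqxx mul1r big1 ?addr0// => k /negbTE->; rewrite mul0r.
rewrite /towards; under eq_bigr do rewrite mulrDl -!mulrA.
by rewrite big_split/= -!mulr_sumr ai; ring.
Qed.

Let towards_simplex p i t : simplex p -> 0 < t <= 1 -> simplex (towards p i t).
Proof.
move=> [p01 p1] /andP[t0 t1]; split => /=.
  move=> k; have := p01 k; rewrite !in_itv/= /towards => /andP[pk0 pk1].
  have : 0 <= (1 - t) * p k by rewrite mulr_ge0// subr_ge0.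
  have : 0 <= (1 - t) * (1 - p k) by rewrite mulr_ge0// subr_ge0.
  by case: (k == i) => /= ? ?; apply/andP; split; lra.
have e (v : I -> R) : \sum_k v k * 1 = \sum_k v k.
  by apply: eq_bigr => k _; rewrite mulr1.
by have := dot_towards p i t (fun=> 1); rewrite !e p1 => ->; ring.
Qed.

(** [y] is the multiplier of the constraints [A], [b] and [t] that of the total mass. The residuals
    [r] and [s] of a minimizer of [phi] yield such multipliers, which contradict the bound [D]
    unless both residuals vanish. *)
Lemma finite_duality (i0 : I) : (forall i, 0 <= c i) ->
  (forall (y : J -> R) t, (forall i, \sum_j y j * A i j + t <= c i) ->
    \sum_j y j * b j + t <= D) ->
  exists p : I -> R, [/\ forall i, 0 <= p i, \sum_i p i = 1,
    forall j, \sum_i p i * A i j = b j & \sum_i p i * c i <= D].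
Proof.
move=> c0 dual.
have S0 : simplex !=set0.
  exists (fun k => (k == i0)%:R); split => [k|] /=.
    by case: (k == i0); rewrite in_itv/= lexx ler01.
  by rewrite (bigD1 i0)//= eqxx big1 ?addr0// => k /negbTE->.
have [p /set_mem Sp pmin] := compact_EVT_min S0 simplex_compact
  (continuous_subspaceT phi_continuous).
pose r j := Ap p j - b j.
pose s := Num.max 0 (cp p - D).
(* [phi] cannot decrease from [p] towards a vertex, and along this segment it is bounded by a
   quadratic polynomial in [t] whose linear coefficient is the difference of the two sides, up to
   the factor 2. *)
have opt i : \sum_j r j * Ap p j + s * cp p <= \sum_j r j * A i j + s * c i.
  pose d j := A i j - Ap p j; pose e := c i - cp p.
  suff : 0 <= \sum_j r j * d j + s * e.
    rewrite /d /e; under eq_bigr do rewrite mulrBr.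
    by rewrite sumrB; lra.
  apply: (@quadratic_ge0 _ (\sum_j d j ^+ 2 + e ^+ 2)) => t t01.
  have /(_ (mem_set (towards_simplex i Sp t01))) := pmin (towards p i t).
  have cpt : cp (towards p i t) - D = (cp p - D) + t * e.
    by rewrite /cp dot_towards -/(cp p) -/e; ring.
  have Apt j : Ap (towards p i t) j - b j = r j + t * d j.
    by rewrite /Ap dot_towards /d /r /Ap; ring.
  rewrite /phi cpt; under [X in _ <= X + _]eq_bigr do rewrite Apt.
  have := max0_sqr_le (cp p - D) (t * e); rewrite -/s => maxle.
  move=> /le_trans/(_ (lerD (lexx _) maxle)).
  rewrite (_ : \sum_j (r j + t * d j) ^+ 2 = \sum_j r j ^+ 2 +
      2 * t * (\sum_j r j * d j) + t ^+ 2 * \sum_j d j ^+ 2); last first.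
    by rewrite !mulr_sumr -!big_split/=; apply: eq_bigr => j _; ring.
  by rewrite -/r -/s; lra.
have rr : \sum_j r j * Ap p j - \sum_j r j * b j = \sum_j r j ^+ 2.
  by rewrite -sumrB; apply: eq_bigr => j _; rewrite /r; ring.
have rr0 : 0 <= \sum_j r j ^+ 2 by apply: sumr_ge0 => j _; exact: sqr_ge0.
have [cpD|cpD] := leP (cp p) D; last first.
  have sE : s = cp p - D by rewrite /s max_r// subr_ge0 ltW.
  have s0 : 0 < s by rewrite sE subr_gt0.
  (* Dividing [opt] by [s] makes this pair feasible; its value is [cp p + (\sum_j r j ^+ 2) / s],
     which exceeds [D]. *)
  have := dual (fun j => - (r j / s)) ((\sum_j r j * Ap p j + s * cp p) / s).
  have scaled (f : J -> R) : \sum_j - (r j / s) * f j = - (\sum_j r j * f j) / s.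
    by rewrite -sumrN mulr_suml; apply: eq_bigr => j _; ring.
  rewrite scaled -mulrDl ler_pdivrMr// => /(_ _)/wrap[i|].
    by rewrite scaled -mulrDl ler_pdivrMr//; have := opt i; lra.
  by nra.
(* If [s = 0], every multiple of the certificate [- r] is dual feasible, because
   [c] is nonnegative, so that its value has to vanish. *)
have s0 : s = 0 by rewrite /s max_l// subr_le0.
have r2 : \sum_j r j ^+ 2 = 0.
  apply/eqP; rewrite eq_le rr0 andbT leNgt; apply/negP => r2_gt0.
  (* Scaled by [l], the certificate has value [|D| + 1], which exceeds [D]. *)
  pose l := (`|D| + 1) / \sum_j r j ^+ 2.
  have l0 : 0 <= l by rewrite divr_ge0// addr_ge0.
  have scaled (f : J -> R) : \sum_j - (l * r j) * f j = - (l * \sum_j r j * f j).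
    by rewrite mulr_sumr -sumrN; apply: eq_bigr => j _; ring.
  have := dual (fun j => - (l * r j)) (l * \sum_j r j * Ap p j).
  rewrite scaled addrC -mulrBr rr => /(_ _)/wrap[i|].
    rewrite scaled addrC -mulrBr (le_trans _ (c0 i))// mulr_ge0_le0// subr_le0.
    by have := opt i; rewrite s0 !mul0r !addr0.
  rewrite /l divfK ?gt_eqF// => Dle; have := ler_norm D; lra.
exists p; split => //.
- by move=> i; have := Sp.1 i; rewrite in_itv/= => /andP[].
- exact: Sp.2.
- move=> j; apply/eqP; rewrite -subr_eq0 -sqrf_eq0; apply/eqP.
  by move: r2 => /psumr_eq0P; apply => // k _; exact: sqr_ge0.
Qed.

End finite_duality.

Lemma bounded_integrable (R : realType) d (T : measurableType d)
    (P : probability T R) (f : T -> R) (M : R) :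
  measurable_fun setT f -> (forall x, `|f x| <= M) ->
  P.-integrable setT (EFin \o f).
Proof.
move=> mf fM; apply: measurable_bounded_integrable => //.
  by rewrite (le_lt_trans (probability_le1 P measurableT))// ltry.
exists M; split; first by rewrite num_real.
by move=> y My x _ /=; rewrite (le_trans (fM x))// ltW.
Qed.

(** * Weak duality *)

Section weak_duality.
Context (R : realType) (K : nat) (X : 'I_K -> pmetricType R).
Hypothesis compactX : forall k, compact [set: X k].
Variable mu : forall k, probability (borel (X k)) R.
Variable c : prodX X -> R.
Hypothesis c_cont : continuous c.

Lemma cost_bounded : exists M, forall x, `|c x| <= M.
Proof.
have cc : continuous (fun x => `|c x|).
  move=> x; apply: (@continuous_comp _ _ _ c Num.norm); first exact: c_cont.
  exact: (@norm_continuous R R^o).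
have [|x _ cx] := compact_EVT_max _ (compact_prodX compactX)
    (continuous_subspaceT cc).
  by exists point.
by exists `|c x| => y; apply: cx; exact: mem_set.
Qed.

Lemma measurable_cost : measurable_fun setT (c : borel (prodX X) -> R).
Proof.
apply: measurable_fun_open => U oU; apply: sub_sigma_algebra.
by apply: open_comp => // x _; exact: c_cont.
Qed.

Lemma cost_integrable (pi : probability (borel (prodX X)) R) :
  pi.-integrable setT (EFin \o c).
Proof.
have [M cM] := cost_bounded.
exact: bounded_integrable measurable_cost cM.
Qed.

(** Change of variables: [mu k] is the law of the coordinate [k] under [pi]. *)
Lemma coupling_integral pi k (h : X k -> R) : couplings mu pi ->
  measurable_fun [set: borel (X k)] h ->
  (mu k).-integrable [set: borel (X k)] (EFin \o h) ->
  pi.-integrable setT (fun x : borel (prodX X) => (h (x k))%:E) /\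
  (\int[mu k]_x (h x)%:E = \int[pi]_x (h (x k))%:E)%E.
Proof.
move=> piP mh ih.
pose proj (x : borel (prodX X)) : borel (X k) := x k.
have mproj : measurable_fun setT proj by exact: measurable_proj.
pose mixin := isMeasurableFun.Build _ _ _ _ proj mproj.
pose G : {mfun borel (prodX X) >-> borel (X k)} := HB.pack proj mixin.
have mhE := (iffRL (measurable_EFinP _ _)) mh.
have muE A : measurable A -> A `<=` setT -> mu k A = distribution pi G A.
  by move=> mA _; rewrite -piP.
have ip : pi.-integrable setT (fun x : borel (prodX X) => (h (x k))%:E).
  apply/integrableP; split; first exact: measurableT_comp mhE mproj.
  have /integrableP[_] := ih.
  rewrite (eq_measure_integral (distribution pi G))//.
  rewrite ge0_integral_distribution//.
  exact: measurableT_comp.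
split => //.
rewrite (eq_measure_integral (distribution pi G))//.
by rewrite (@integral_distribution _ _ _ _ _ _ G (EFin \o h)).
Qed.

Lemma J_le_cost f pi : admissible c mu f -> couplings mu pi ->
  (J mu f <= \int[pi]_x (c x)%:E)%E.
Proof.
move=> [mf intf fc] piP; rewrite /J.
under eq_bigr => k _.
  rewrite (coupling_integral piP (mf k) (intf k)).2; over.
have ifk k := (coupling_integral piP (mf k) (intf k)).1.
rewrite -integral_sum//.
apply: le_integral => //.
- exact: integrable_sum.
- exact: cost_integrable.
- by move=> x _; rewrite sumEFin lee_fin.
Qed.

End weak_duality.

(** * c-transforms *)

Section ctransform.
Context (R : realType) (K : nat) (X : 'I_K -> pmetricType R).
Variable c : prodX X -> R.

(** The real [inf] takes a default value on sets without lower bound; under [csub h] the number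
    [h k x] is a lower bound, and the infimum is genuine. *)
Definition ctransform k (h : forall l, X l -> R) (x : X k) : R :=
  inf [set c z - \sum_(l < K | l != k) h l (z l) |
       z in [set z : prodX X | z k = x]].

(** The pointwise part of [admissible]; measurability and integrability are recovered from
    [cmodulus] and a uniform bound. *)
Definition csub (f : forall l, X l -> R) := forall z : prodX X, \sum_l f l (z l) <= c z.

(* The modulus of continuity inherited from [c] by all c-transforms. *)
Definition cmodulus k (g : X k -> R) := forall (x y : X k) b,
  (forall z : prodX X, `|c (dfwith z k x) - c (dfwith z k y)| <= b) ->
  g x - g y <= b.

Lemma dfwith_id (z : prodX X) k : dfwith z k (z k) = z.
Proof. by apply: functional_extensionality_dep => l; case: dfwithP. Qed.

Lemma sum_dfwith_point (f : forall l, X l -> R) (z : prodX X) k (x : X k) :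
  \sum_(l < K | l != k) f l (dfwith z k x l) = \sum_(l < K | l != k) f l (z l).
Proof. by apply: eq_bigr => l lk; rewrite dfwithout// eq_sym. Qed.

Lemma sum_dfwith_family (f : forall l, X l -> R) (z : prodX X) k (g : X k -> R) :
  \sum_(l < K | l != k) dfwith f k g l (z l) = \sum_(l < K | l != k) f l (z l).
Proof. by apply: eq_bigr => l lk; rewrite dfwithout// eq_sym. Qed.

Lemma sum_cst_le k (B : R) : 0 <= B -> \sum_(l < K | l != k) B <= K%:R * B.
Proof.
move=> B0; have -> : K%:R * B = \sum_(l < K) B by rewrite sumr_const card_ord mulr_natl.
by rewrite [leRHS](bigD1 k)//= lerDr.
Qed.

Section one_component.
Variables (f : forall l, X l -> R) (k : 'I_K).
Hypothesis fc : csub f.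

Lemma csub_le (z : prodX X) : @f k (z k) <= c z - \sum_(l < K | l != k) @f l (z l).
Proof. by have := fc z; rewrite (bigD1 k)//=; lra. Qed.

Let S x := [set c z - \sum_(l < K | l != k) @f l (z l) |
       z in [set z : prodX X | z k = x]].

Let S_neq0 x : S x !=set0.
Proof.
exists (c (dfwith point k x) - \sum_(l < K | l != k) @f l (dfwith (point : prodX X) k x l)).
by exists (dfwith point k x) => //=; rewrite dfwithin.
Qed.

Let S_lb x : lbound (S x) (@f k x).
Proof. by move=> _ [z /= <- <-]; exact: csub_le. Qed.

Lemma ctransform_ge x : @f k x <= ctransform f x.
Proof. exact: lb_le_inf (S_neq0 x) (@S_lb x). Qed.

Lemma ctransform_le (z : prodX X) :
  ctransform f (z k) <= c z - \sum_(l < K | l != k) @f l (z l).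
Proof. by apply: ge_inf; [exists (@f k (z k)); exact: S_lb|exists z]. Qed.

Lemma ctransform_cconj : cconj c (ctransform f (k := k)).
Proof.
exists f => x; rewrite -ereal_inf_EFin.
- congr ereal_inf; apply/seteqP; split => [_ [_ [z zx <-] <-]|_ [z zx <-]].
    by exists z.
  by exists (c z - \sum_(l < K | l != k) @f l (z l)) => //; exists z.
- by exists (@f k x); exact: S_lb.
- exact: S_neq0.
Qed.

(** With the other coordinates fixed, moving from [x] to [y] changes each competitor in the infimum
    by at most [b]. *)
Lemma ctransform_cmodulus : cmodulus (ctransform f (k := k)).
Proof.
move=> x y b xyb; rewrite lerBlDl -lerBlDr; apply: lb_le_inf (S_neq0 y) _.
move=> _ [z /= zy <-]; rewrite lerBlDr.
have := ctransform_le (dfwith z k x); rewrite dfwithin => /le_trans; apply.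
rewrite sum_dfwith_point.
have zE : dfwith z k y = z by rewrite -zy dfwith_id.
by have := xyb z; rewrite zE ler_norml => /andP[]; lra.
Qed.

Lemma csub_ctransform : csub (dfwith f k (ctransform f (k := k))).
Proof.
move=> z; rewrite (bigD1 k)//= dfwithin.
rewrite sum_dfwith_family.
by have := ctransform_le z; lra.
Qed.

Lemma ctransform_bounded (M B : R) (x : X k) : (forall z, `|c z| <= M) -> 0 <= B ->
  (forall l y, l != k -> `|@f l y| <= B) -> `|ctransform f x| <= M + K%:R * B.
Proof.
move=> cM B0 fB.
have sumB (z : prodX X) : `|\sum_(l < K | l != k) @f l (z l)| <= K%:R * B.
  apply: le_trans (sum_cst_le k B0); apply: le_trans (ler_norm_sum _ _ _) _.
  by apply: ler_sum => l /fB.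
rewrite ler_norml; apply/andP; split.
  apply: lb_le_inf (S_neq0 x) _ => _ [z _ <-].
  have := cM z; have := sumB z; rewrite !ler_norml => /andP[? ?] /andP[? ?]; lra.
have := ctransform_le (dfwith point k x); rewrite dfwithin => /le_trans; apply.
set z := dfwith _ _ _.
have := cM z; have := sumB z; rewrite !ler_norml => /andP[? ?] /andP[? ?]; lra.
Qed.

End one_component.

(** Transforming in index order preserves [csub]. Later steps do no harm to a component already
    treated: [cconj] asks for some [h], and the family present at its own step remains a witness. *)
Lemma ctransform_all (f : forall l, X l -> R) : csub f ->
  exists g : forall l, X l -> R, [/\ csub g, forall k x, f k x <= g k x,
    forall k, cconj c (g k) & forall k, cmodulus (g k)].
Proof.
move=> fc; suff /(_ K (leqnn K))[g [gc fg gP]] : forall n, (n <= K)%N ->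
    exists g : forall l, X l -> R, [/\ csub g, forall k x, f k x <= g k x &
      forall k : 'I_K, (k < n)%N -> cconj c (g k) /\ cmodulus (g k)].
  by exists g; split => // k; have [] := gP k (ltn_ord k).
elim=> [_|n IH nK]; first by exists f.
have [g [gc fg gP]] := IH (ltnW nK).
pose j : 'I_K := Ordinal nK.
exists (dfwith g j (ctransform g (k := j))); split => [|k x|k].
- exact: csub_ctransform.
- rewrite (le_trans (fg k x))//; have [kj|kj] := eqVneq k j.
    by subst k; rewrite dfwithin; exact: ctransform_ge.
  by rewrite dfwithout// eq_sym.
- rewrite ltnS leq_eqVlt => kn; have [kj|kj] := eqVneq k j.
    subst k; rewrite dfwithin; split; first exact: ctransform_cconj.
    exact: ctransform_cmodulus.
  rewrite dfwithout 1?eq_sym//; apply: gP.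
  by case/orP : kn => // /eqP kn; move: kj; rewrite -val_eqE/= kn eqxx.
Qed.

Lemma cmodulus_osc k (g : X k -> R) (M : R) x : (forall z, `|c z| <= M) ->
  cmodulus g -> `|g x - g point| <= 2 * M.
Proof.
move=> cM gm; have cc (u v : prodX X) : `|c u - c v| <= 2 * M.
  have := cM u; have := cM v; rewrite !ler_norml => /andP[? ?] /andP[? ?].
  by apply/andP; split; lra.
rewrite ler_norml lerNl opprB; apply/andP; split; exact: gm.
Qed.

Lemma csub_upper (f : forall l, X l -> R) k x (M B : R) : (forall z, `|c z| <= M) ->
  csub f -> (forall l y, - B <= f l y) -> 0 <= B -> f k x <= M + K%:R * B.
Proof.
move=> cM fc fB B0.
have := csub_le k fc (dfwith point k x); rewrite dfwithin sum_dfwith_point.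
move=> /le_trans; apply; apply: lerD; first by rewrite (le_trans (ler_norm _)).
apply: le_trans (sum_cst_le k B0); rewrite -sumrN.
by apply: ler_sum => l _; rewrite lerNl.
Qed.

(** [B] is independent of [f], so all improved families lie in one compact set. Since the [a k] sum
    to 0, the improvement cannot lower the dual value. *)
Lemma ctransform_improvement (M : R) (k0 : 'I_K) : (forall z, `|c z| <= M) ->
  exists B, forall f : forall l, X l -> R, csub f ->
  exists (g : forall l, X l -> R) (a : 'I_K -> R),
    [/\ csub g, \sum_k a k = 0, forall k x, f k x <= g k x + a k,
        forall k, cconj c (g k) & forall k, cmodulus (g k)] /\
    forall k x, `|g k x| <= B.
Proof.
move=> cM; have M0 : 0 <= M by rewrite (le_trans _ (cM point)).
(* [B1] bounds a c-transform of components bounded by the oscillation [2 * M] of [c]; [B2] bounds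
   from above a family satisfying [csub] whose components are at least [- B1]. *)
pose B1 := M + K%:R * (2 * M); pose B2 := M + K%:R * B1.
have K1 : 1 <= K%:R :> R by rewrite ler1n (leq_ltn_trans _ (ltn_ord k0)).
have B1_2M : 2 * M <= B1 by rewrite /B1; nra.
have B1B2 : B1 <= B2 by rewrite /B2; nra.
(* The first round of c-transforms gives all components the modulus of [c].  The
   constants [a] then bound all of them but [k0], the transform at [k0] bounds
   the last one, and a second round makes all of them c-conjugates. *)
exists B2 => f fc.
have [g1 [g1c fg1 _ g1m]] := ctransform_all fc.
(* For [k != k0] this makes [g2 k] vanish at [point], so that its oscillation bounds it; the value
   at [k0] balances the sum. *)
pose a k := if k == k0 then - \sum_(l < K | l != k0) g1 l point else g1 k point.
have a0 : \sum_k a k = 0.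
  rewrite (bigD1 k0)//= /a eqxx addrC [X in X - _](eq_bigr (fun l => g1 l point)) ?subrr//.
  by move=> l /negbTE->.
pose g2 k x := g1 k x - a k.
have g2c : csub g2.
  by move=> z; rewrite /g2 sumrB a0 subr0.
have g2_le l y : l != k0 -> `|g2 l y| <= 2 * M.
  by move=> /negbTE lk0; rewrite /g2 /a lk0; exact: cmodulus_osc.
pose g3 := dfwith g2 k0 (ctransform g2 (k := k0)).
have g3_le l y : `|g3 l y| <= B1.
  have [lk|lk] := eqVneq l k0.
    by subst l; rewrite /g3 dfwithin; apply: ctransform_bounded => //; lra.
  by rewrite /g3 dfwithout 1?eq_sym// (le_trans (g2_le _ _ lk)).
have g23 l y : g2 l y <= g3 l y.
  have [lk|lk] := eqVneq l k0.
    by subst l; rewrite /g3 dfwithin; exact: ctransform_ge.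
  by rewrite /g3 dfwithout// eq_sym.
have [g4 [g4c g34 g4cc g4m]] := ctransform_all (csub_ctransform k0 g2c).
exists g4, a; split; first split => //.
  move=> k x; rewrite -lerBlDr (le_trans _ (g34 _ _))// (le_trans _ (g23 _ _))// lerD2r//.
have g4_lb k x : - B1 <= g4 k x.
  by rewrite (le_trans _ (g34 _ _))//; have := g3_le k x; rewrite ler_norml => /andP[].
move=> k x; rewrite ler_norml (csub_upper _ cM)//; last lra.
by rewrite andbT (le_trans _ (g4_lb _ _))// lerN2.
Qed.

End ctransform.

(** * The dual maximizer *)

Lemma le_integral_shift (R : realType) d (T : measurableType d)
    (P : probability T R) (f g : T -> R) (a : R) :
  P.-integrable setT (EFin \o f) -> P.-integrable setT (EFin \o g) ->
  (forall x, f x <= g x + a) ->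
  (\int[P]_x (f x)%:E <= \int[P]_x (g x)%:E + a%:E)%E.
Proof.
move=> intf intg fg.
have inta : P.-integrable setT (EFin \o cst a) by exact: finite_measure_integrable_cst.
have <- : (\int[P]_x cst a%:E x = a%:E)%E.
  by rewrite integral_cst// -[RHS]mule1; congr (_ * _)%E; exact: probability_setT.
rewrite -(integralD _ intg inta)//; apply: le_integral => //.
  exact: integrableD.
by move=> x _; rewrite -EFinD lee_fin.
Qed.

Section dual_maximizer.
Context (R : realType) (K : nat) (X : 'I_K -> pmetricType R).
Hypothesis compactX : forall k, compact [set: X k].
Variable mu : forall k, probability (borel (X k)) R.
Variable c : prodX X -> R.
Hypothesis c_cont : continuous c.

(** Equicontinuity: replacing one coordinate by a nearby point stays within a box, so a single
    radius from the uniform continuity of [c] serves every [k] and [g]. *)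
Lemma cmodulus_unif (e : R) : 0 < e -> exists2 r : R, 0 < r &
  forall k (g : X k -> R), cmodulus c g ->
    forall x y, ball x r y -> `|g x - g y| <= e.
Proof.
move=> e0; have [r r0 rP] := box_unif_continuous compactX c_cont e0.
exists r => // k g gm x y xy.
have boxP (z : prodX X) u v : ball u r v -> box (dfwith z k u) r (dfwith z k v).
  move=> uv l; have [lk|lk] := eqVneq l k; first by subst l; rewrite !dfwithin.
  by rewrite !dfwithout 1?eq_sym//; exact: ballxx.
rewrite ler_norml lerNl opprB; apply/andP; split; apply: gm => z; apply: rP.
  by apply: boxP; exact: ball_sym.
exact: boxP.
Qed.

Lemma cmodulus_measurable k (g : X k -> R) : cmodulus c g ->
  measurable_fun [set: borel (X k)] g.
Proof.
move=> gm; apply: measurable_fun_open => U oU; apply: open_borel.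
apply: open_comp => // x _ V /nbhs_ballP[e /= e0 eV].
have e20 : 0 < e / 2 by rewrite divr_gt0.
have [r r0 rP] := cmodulus_unif e20.
apply/nbhs_ballP; exists r => //= y xy; apply: eV.
by rewrite /ball/= (le_lt_trans (rP _ _ gm _ _ xy))// ltr_pdivrMr// ltr_pMr// ltr1n.
Qed.

Lemma bounded_cmodulus_integrable k (g : X k -> R) B : cmodulus c g ->
  (forall x, `|g x| <= B) -> (mu k).-integrable [set: borel (X k)] (EFin \o g).
Proof.
move=> gm gB; apply: (@bounded_integrable R _ (borel (X k)) (mu k) g B) => //.
exact: cmodulus_measurable.
Qed.

Lemma J_shift (f g : forall k, X k -> R) (a : 'I_K -> R) :
  (forall k, (mu k).-integrable [set: borel (X k)] (EFin \o f k)) ->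
  (forall k, (mu k).-integrable [set: borel (X k)] (EFin \o g k)) ->
  (forall k x, f k x <= g k x + a k) ->
  (J mu f <= J mu g + (\sum_k a k)%:E)%E.
Proof.
move=> intf intg fg; rewrite -sumEFin -big_split/=; apply: lee_sum => k _.
exact: le_integral_shift.
Qed.

Lemma J_fin_num (f : forall k, X k -> R) :
  (forall k, (mu k).-integrable [set: borel (X k)] (EFin \o f k)) ->
  J mu f \is a fin_num.
Proof.
by move=> intf; apply/sum_fin_numP => k _ _; exact: integrable_fin_num.
Qed.

(** A family is encoded as one function on the disjoint union of the [X k], so that a single product
    space carries pointwise convergence. *)
Definition component (F : {ptws {k & X k} -> R}) k (x : X k) : R :=
  F (Tagged (fun k => X k) x).

(** Each condition is a set of weak inequalities between finitely many values of [F], hence closed.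
    Conjugacy is left out and restored by one more improvement of the maximizer. *)
Definition potentials (B : R) : set {ptws {k & X k} -> R} :=
  [set F | forall s, F s \in `[- B, B]] `&`
  ([set F | forall k, cmodulus c (component F (k := k))] `&`
   [set F | csub c (component F)]).

Let component_continuous k (x : X k) :
  continuous (fun F : {ptws {k & X k} -> R} => component F x).
Proof. exact: (@proj_continuous _ (fun=> R)). Qed.

Let closed_pointwise_le (I : Type) (D : set I)
    (phi : I -> {ptws {k & X k} -> R} -> R) (r : I -> R) :
  (forall i, continuous (phi i)) ->
  closed [set F | forall i, D i -> phi i F <= r i].
Proof.
move=> cphi.
rewrite (_ : [set _ | _] = \bigcap_(i in D) (phi i @^-1` [set y | y <= r i])).
  apply: closed_bigI => i _; apply: closed_comp => [F _|]; first exact: cphi.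
  exact: closed_le.
by apply/seteqP; split.
Qed.

Lemma potentials_compact B : compact (potentials B).
Proof.
apply: compact_closedI.
  have := @tychonoff {k & X k} (fun=> R) (fun=> `[- B, B]%classic)
    (fun=> segment_compact (R := R) (a := - B) (b := B)).
  by congr compact; apply/seteqP; split.
apply: closedI.
  rewrite (_ : [set _ | _] = \bigcap_(k in setT) [set F | forall i : X k * X k * R,
      (forall z : prodX X, `|c (dfwith z k i.1.1) - c (dfwith z k i.1.2)| <= i.2) ->
      component F i.1.1 - component F i.1.2 <= i.2]).
    apply: closed_bigI => k _; apply: closed_pointwise_le => i F.
    apply: (@continuousB _ R^o _ (fun F => component F i.1.1)
      (fun F => component F i.1.2));
      exact: component_continuous.
  apply/seteqP; split => F FP k; first by move=> _ [[x y] b]; exact: FP.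
  by move=> x y b; exact: (FP k I (x, y, b)).
rewrite (_ : [set _ | _] =
    [set F | forall z : prodX X, [set: prodX X] z -> \sum_l component F (z l) <= c z]).
  apply: closed_pointwise_le => z; apply: continuous_sum => l.
  exact: component_continuous.
by apply/seteqP; split => F FP z => [_|]; exact: FP.
Qed.

Lemma potentials_integrable B F k : potentials B F ->
  (mu k).-integrable [set: borel (X k)] (EFin \o component F (k := k)).
Proof.
move=> [FB [Fm _]]; apply: (bounded_cmodulus_integrable (Fm k) (B := B)) => x.
by have := FB (Tagged (fun k => X k) x); rewrite in_itv/= ler_norml.
Qed.

(** By equicontinuity, closeness on a finite net, which is a pointwise neighbourhood condition,
    implies uniform closeness. *)
Lemma J_within_continuous (k0 : 'I_K) B :
  {within potentials B, continuous (fun F => fine (J mu (component F)))}.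
Proof.
apply/subspace_continuousP => F EF; apply/cvgrPdist_le => e e0.
(* Each of the [K] integrals may change by [3 * d]: one [d] to reach the net point in [F], one to
   pass to [G], one to return. *)
pose d := e / (3 * K%:R).
have K1 : 0 < K%:R :> R by rewrite ltr0n (leq_ltn_trans _ (ltn_ord k0)).
have d0 : 0 < d by rewrite divr_gt0// mulr_gt0.
have [r r0 rP] := cmodulus_unif d0.
pose s k := sval (cid (compact_ball_cover (@compactX k) r0)).
have sP k : forall x, has (fun t => `[< (ball t r)° x >]) (s k).
  exact: (svalP (cid (compact_ball_cover (@compactX k) r0))).
have net : \forall G \near nbhs F, forall k (i : 'I_(size (s k))),
    `|component F (nth point (s k) i) - component G (nth point (s k) i)| <= d.
  apply: filter_forall => k; apply: filter_forall => i.
  have /cvgrPdist_le := @component_continuous k (nth point (s k) i) F.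
  exact.
near=> G.
have EG : potentials B G by near: G; exact: withinT.
have netG : forall k (i : 'I_(size (s k))),
    `|component F (nth point (s k) i) - component G (nth point (s k) i)| <= d.
  by near: G; exact: cvg_within net.
have close k x : `|component F (k := k) x - component G x| <= 3 * d.
  have /(hasP)[t ts /asboolP/interior_subset tx] := sP k x.
  have it : (index t (s k) < size (s k))%N by rewrite index_mem.
  have := netG k (Ordinal it); rewrite /= nth_index// => FGt.
  have := rP _ _ (EF.2.1 k) _ _ tx; have := rP _ _ (EG.2.1 k) _ _ tx.
  move: FGt; rewrite !ler_norml => /andP[? ?] /andP[? ?] /andP[? ?].
  by apply/andP; split; lra.
have sumd : \sum_(k < K) 3 * d = e.
  rewrite sumr_const card_ord -mulr_natl /d; field.
  by rewrite gt_eqF.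
have FGe : (J mu (component F) <= J mu (component G) + e%:E)%E.
  rewrite -sumd; apply: J_shift => [k|k|k x].
  - exact: potentials_integrable EF.
  - exact: potentials_integrable EG.
  by have := close k x; rewrite ler_norml => /andP[]; lra.
have GFe : (J mu (component G) <= J mu (component F) + e%:E)%E.
  rewrite -sumd; apply: J_shift => [k|k|k x].
  - exact: potentials_integrable EG.
  - exact: potentials_integrable EF.
  by have := close k x; rewrite ler_norml => /andP[]; lra.
have JF : J mu (component F) = (fine (J mu (component F)))%:E.
  by rewrite fineK//; apply: J_fin_num => k; exact: potentials_integrable EF.
have JG : J mu (component G) = (fine (J mu (component G)))%:E.
  by rewrite fineK//; apply: J_fin_num => k; exact: potentials_integrable EG.
rewrite JF JG -!EFinD !lee_fin in FGe GFe.
by rewrite /from_subspace ler_norml; apply/andP; split; lra.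
Unshelve. all: by end_near. Qed.

Hypothesis c_ge0 : forall x, 0 <= c x.

Lemma dual_maximizer (k0 : 'I_K) : exists f : forall k, X k -> R,
  [/\ admissible c mu f, forall k, cconj c (f k) &
      forall g, admissible c mu g -> (J mu g <= J mu f)%E].
Proof.
have [M cM] := cost_bounded compactX c_cont.
have [B BP] := ctransform_improvement k0 cM.
pose curry (g : forall k, X k -> R) : {ptws {k & X k} -> R} :=
  fun s => g (tag s) (tagged s).
have curryP (g : forall k, X k -> R) : csub c g -> (forall k, cmodulus c (g k)) ->
    (forall k x, `|g k x| <= B) -> potentials B (curry g).
  move=> gc gm gB; split; last by split.
  by move=> s; rewrite /= in_itv/= -ler_norml; exact: gB.
have E0 : potentials B !=set0.
  have zc : csub c (fun k (x : X k) => 0) by move=> z; rewrite big1.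
  have [g [a [[gc _ _ _ gm] gB]]] := BP _ zc.
  by exists (curry g); exact: curryP.
have [F /set_mem EF Fmax] := compact_EVT_max E0 (@potentials_compact B)
  (@J_within_continuous k0 B).
(* Improving the maximizer [F] makes it conjugate without lowering its value; a competitor [g] is
   improved likewise to enter [potentials B]. *)
have [f [a [[fc a0 Ff fcc fm] fB]]] := BP _ EF.2.2.
have intf k := bounded_cmodulus_integrable (fm k) (fB k).
have le0 (g h : forall k, X k -> R) : (J mu g <= J mu h + 0%:E -> J mu g <= J mu h)%E.
  by rewrite adde0.
exists f; split => // [|g [mg intg gc]].
  by split => // k; exact: cmodulus_measurable.
have [g' [b [[g'c b0 gg' _ g'm] g'B]]] := BP _ gc.
have intg' k := bounded_cmodulus_integrable (g'm k) (g'B k).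
apply: (@le_trans _ _ (J mu g')).
  by apply: le0; rewrite -b0; exact: J_shift.
apply: (@le_trans _ _ (J mu (component F))); last first.
  by apply: le0; rewrite -a0; apply: J_shift => // k; exact: potentials_integrable EF.
have := Fmax _ (mem_set (curryP _ g'c g'm g'B)).
rewrite -lee_fin !fineK//; last exact: J_fin_num.
by apply: J_fin_num => k; exact: potentials_integrable EF.
Qed.

End dual_maximizer.

(** * Strong duality *)

Section finite_partition.
Context (R : realType) d (T : measurableType d) (P : probability T R).
Context (n : nat) (q : T -> 'I_n).
Hypothesis mq : forall j, measurable [set x | q x = j].

Lemma measure_fibers (A : set T) : measurable A ->
  P A = (\sum_j P (A `&` [set x | q x = j]))%E.
Proof.
move=> mA; rewrite -(@measure_bigsetU_ord _ _ _ P n predT).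
- congr (P _); rewrite -bigcup_seq; apply/seteqP; split => [x Ax|x [j _ []]//].
  by exists (q x) => //=; rewrite mem_index_enum.
- by move=> j; exact: measurableI.
- apply/trivIsetP => i j _ _ ij; apply/seteqP; split => // x [[_ xi] [_ xj]].
  by move: ij; rewrite -xi -xj eqxx.
Qed.

Variable v : 'I_n -> R.

Lemma step_measurable : measurable_fun setT (v \o q).
Proof.
move=> _ Y mY; rewrite setTI.
rewrite (_ : _ @^-1` _ = \bigcup_(j in [set j | Y (v j)]) [set x | q x = j]).
  exact: fin_bigcup_measurable.
by apply/seteqP; split => [x Yx|x [j /= + xj]]; [exists (q x)|rewrite -xj].
Qed.

Lemma step_integrable : P.-integrable setT (EFin \o (v \o q)).
Proof.
apply: (@bounded_integrable _ _ _ _ _ (\sum_j `|v j|)); first exact: step_measurable.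
by move=> x; rewrite (bigD1 (q x))//= lerDl; exact: sumr_ge0.
Qed.

Lemma step_integral :
  (\int[P]_x (v (q x))%:E = (\sum_j v j * fine (P [set x | q x = j]))%:E)%E.
Proof.
have -> : (fun x => (v (q x))%:E) =
    (fun x => \sum_j (v j)%:E * (\1_[set x | q x = j] x)%:E)%E.
  apply/funext => x; under eq_bigr do rewrite -EFinM.
  rewrite sumEFin (bigD1 (q x))//= big1 ?addr0.
    by rewrite indicE mem_set// mulr1.
  move=> j /eqP jx; rewrite indicE memNset ?mulr0//= => xj.
  by apply: jx.
have ii j : P.-integrable setT (fun x => (\1_[set x | q x = j] x)%:E).
  exact: integrable_indic.
rewrite integral_sum//; last by move=> j; exact: integrableZl.
rewrite -sumEFin; apply: eq_bigr => j _.
rewrite integralZl// integral_indic// setIT EFinM fineK//.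
exact: fin_num_measure.
Qed.

End finite_partition.

(** The convex combination is a finite sum of scaled measures; [I] is enumerated because [msum] is
    indexed by natural numbers. *)
Lemma mixture (R : realType) d (T : measurableType d) (I : finType)
    (p : I -> R) (P : I -> probability T R) :
  (forall i, 0 <= p i) -> \sum_i p i = 1 ->
  exists Q : probability T R,
    (forall A, Q A = \sum_i (p i)%:E * P i A)%E /\
    (forall f : T -> \bar R, measurable_fun setT f -> (forall x, 0 <= f x)%E ->
      \int[Q]_x f x = \sum_i (p i)%:E * \int[P i]_x f x)%E.
Proof.
move=> p0 p1.
pose s := index_enum I.
have [i0 _|I0] := pickP (fun _ : I => true); last first.
  by move: p1; rewrite big_pred0// => /esym/eqP; rewrite oner_eq0.
have enumE (F : I -> \bar R) :
    (\sum_i F i = \sum_(n < size s) F (nth i0 s n))%E.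
  by rewrite -/s (big_nth i0) big_mkord.
pose m n : {measure set T -> \bar R} := mscale (NngNum (p0 (nth i0 s n))) (P (nth i0 s n)).
have mE A : msum m (size s) A = (\sum_i (p i)%:E * P i A)%E by rewrite enumE.
have m1 : msum m (size s) [set: T] = 1%E.
  rewrite mE; under eq_bigr do rewrite probability_setT mule1.
  by rewrite sumEFin p1.
have [Q QE] := measure1_probability m1.
exists Q; split => [A|f mf f0]; first by rewrite QE; exact: mE.
rewrite (eq_measure_integral (msum m (size s))); last by move=> A mA _; exact: QE.
rewrite ge0_integral_measure_sum// enumE; apply: eq_bigr => n _.
by rewrite ge0_integral_mscale.
Qed.

(** This is conditioning on [D]; positive mass excludes the fallback [P']. *)
Lemma mnormalize_mrestrE (R : realType) d (T : measurableType d)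
    (P P' : probability T R) (D A : set T) (mD : measurable D) :
  0 < fine (P D) ->
  mnormalize (mrestr P mD) P' A = (P (A `&` D) * (fine (P D))^-1%:E)%E.
Proof.
move=> D0; have PDE : P D = (fine (P D))%:E by rewrite fineK// fin_num_measure.
by rewrite /mnormalize/= /mrestr setTI PDE eqe gt_eqF.
Qed.

Section strong_duality.
Context (R : realType) (K : nat) (X : 'I_K -> pmetricType R).
Hypothesis compactX : forall k, compact [set: X k].
Variable mu : forall k, probability (borel (X k)) R.
Variable c : prodX X -> R.
Hypothesis c_cont : continuous c.
Hypothesis c_ge0 : forall x, 0 <= c x.

Section cells.
Context (N : nat) (q : forall k, X k -> 'I_N.+1).
Hypothesis mq : forall k j, measurable ([set x | @q k x = j] : set (borel (X k))).

Let fiber k j : set (borel (X k)) := [set x | @q k x = j].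
Let cell (i : {ffun 'I_K -> 'I_N.+1}) : set (prodX X) :=
  [set z | forall k, @q k (z k) = i k].
Let weight k j : R := fine (mu k (@fiber k j)).

Lemma step_csub_J (g : 'I_K -> 'I_N.+1 -> R) (D : R) :
  (forall h, admissible c mu h -> (J mu h <= D%:E)%E) ->
  csub c (fun k x => g k (@q k x)) ->
  \sum_k \sum_j g k j * weight k j <= D.
Proof.
move=> dual gc.
have : admissible c mu (fun k x => g k (@q k x)).
  split => // k.
    exact: (@step_measurable R _ (borel (X k)) _ (@q k) (@mq k) (g k)).
  exact: (@step_integrable R _ (borel (X k)) (mu k) _ (@q k) (@mq k) (g k)).
move=> /dual; rewrite /J.
under eq_bigr => k _.
  rewrite (@step_integral R _ (borel (X k)) (mu k) _ (@q k) (@mq k) (g k)); over.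
by rewrite sumEFin lee_fin.
Qed.

(** Couples the [mu k] conditioned on the sides of the cell. The positivity assumption comes after
    the existential so that a measure can be chosen for every cell, including those of zero
    weight. *)
Lemma cell_coupling (i : {ffun 'I_K -> 'I_N.+1}) :
  exists pi : probability (borel (prodX X)) R,
  (forall k, 0 < weight k (i k)) ->
  (forall k (A : set (borel (X k))), measurable A ->
     fine (pi [set x | A (x k)]) = fine (mu k (A `&` @fiber k (i k))) / weight k (i k)) /\
  {ae pi, forall x, cell i x}.
Proof.
pose nu k : probability (borel (X k)) R := mnormalize (mrestr (mu k) (@mq k (i k))) (mu k).
have [pi piP] := coupling_exists compactX nu.
exists pi => w0.
have nuE k (A : set (borel (X k))) :
    nu k A = (mu k (A `&` @fiber k (i k)) * (weight k (i k))^-1%:E)%E.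
  exact: (@mnormalize_mrestrE R _ (borel (X k)) (mu k) (mu k) _ A (@mq k (i k)) (w0 k)).
split => [k A mA|].
  have := piP k A mA; rewrite /pushforward => piE.
  rewrite (_ : pi _ = nu k A)// nuE fineM//.
  by apply: fin_num_measure; apply: measurableI => //; exact: mq.
apply: filter_forall => k.
have mC : measurable (~` @fiber k (i k)) by apply: measurableC; exact: mq.
exists [set x | (~` @fiber k (i k)) (x k)]; split => //.
  exact: measurable_cylinder mC.
have := piP k _ mC; rewrite /pushforward => piE.
by rewrite (_ : pi _ = nu k (~` @fiber k (i k)))// nuE setICl measure0 mul0e.
Qed.

(** The plan mixes the cell couplings with weights [p]. In the marginal [k], the [p i] with
    [i k = j] add up to [weight k j], which cancels the normalization of the conditioned measure. *)
Lemma cell_plan (p : {ffun 'I_K -> 'I_N.+1} -> R) :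
  (forall i, 0 <= p i) -> \sum_i p i = 1 ->
  (forall k j, \sum_i p i * (i k == j)%:R = weight k j) ->
  exists2 pi, couplings mu pi &
    forall e (C : {ffun 'I_K -> 'I_N.+1} -> R),
      (forall i, 0 <= C i + e) ->
      (forall i z, cell i z -> c z <= C i + e) ->
      (\int[pi]_x (c x)%:E <= (\sum_i p i * C i + e)%:E)%E.
Proof.
move=> p0 p1 pw.
pose rho i := sval (cid (cell_coupling i)).
have rhoP i : p i != 0 ->
    (forall k (A : set (borel (X k))), measurable A ->
      fine (rho i [set x | A (x k)]) = fine (mu k (A `&` @fiber k (i k))) / weight k (i k)) /\
    {ae rho i, forall x, cell i x}.
  (* By [pw], each side of a cell has weight at least [p i], so a charged cell can be conditioned
     on. *)
  move=> pi0; apply: (svalP (cid (cell_coupling i))) => k.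
  rewrite -pw (bigD1 i)//= eqxx mulr1 ltr_pwDl//; first by rewrite lt_neqAle eq_sym pi0 p0.
  by apply: sumr_ge0 => l _; rewrite mulr_ge0.
have [Q [QE Qint]] := mixture rho p0 p1.
exists Q => [k A mA|e C C0 cC].
  have mAk : measurable ([set x | A (x k)] : set (borel (prodX X))).
    exact: measurable_cylinder mA.
  pose W j := fine (mu k (A `&` @fiber k j)) / weight k j.
  have finA (j : 'I_N.+1) : mu k (A `&` @fiber k j) \is a fin_num.
    by apply: fin_num_measure; apply: measurableI => //; exact: mq.
  have finF (j : 'I_N.+1) : mu k (@fiber k j) \is a fin_num.
    by apply: fin_num_measure; exact: mq.
  have weightW j : weight k j * W j = fine (mu k (A `&` @fiber k j)).
    (* On a null fiber the quotient [W j] is meaningless, but both sides vanish. *)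
    have [w0|w0] := eqVneq (weight k j) 0; last by rewrite /W mulrC divfK.
    rewrite w0 mul0r; apply/esym/eqP; rewrite eq_le fine_ge0// andbT -w0.
    apply: fine_le; [exact: finA|exact: (finF j)|].
    have mAj : measurable (A `&` @fiber k j) by apply: measurableI => //; exact: mq.
    by apply: le_measure; [exact: mem_set|exact: mem_set (@mq k j)|].
  rewrite /pushforward (_ : Q _ = \sum_i (p i)%:E * rho i [set x | A (x k)])%E//.
  rewrite (@measure_fibers R _ (borel (X k)) (mu k) _ (@q k) (@mq k) A mA).
  transitivity ((\sum_i p i * W (i k))%:E)%E.
    rewrite -sumEFin; apply: eq_bigr => i _.
    have [->|pi0] := eqVneq (p i) 0; first by rewrite mul0e mul0r.
    have <- : fine (rho i [set x | A (x k)]) = W (i k) by exact: (rhoP i pi0).1.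
    by rewrite EFinM fineK// fin_num_measure.
  rewrite (eq_bigr (fun j => (weight k j * W j)%:E)); last first.
    by move=> j _; rewrite weightW fineK//; exact: finA.
  rewrite sumEFin; congr EFin.
  under [RHS]eq_bigr do rewrite -pw mulr_suml.
  rewrite exchange_big/=; apply: eq_bigr => i _.
  rewrite (bigD1 (i k))//= eqxx mulr1 big1 ?addr0// => j /negbTE ji.
  by rewrite eq_sym ji mulr0 mul0r.
have mc : measurable_fun setT (EFin \o (c : borel (prodX X) -> R)).
  by apply/measurable_EFinP; exact: measurable_cost.
rewrite (Qint _ mc) => [|x]; last by rewrite lee_fin.
rewrite (_ : _ + e = \sum_i p i * (C i + e)); last first.
  by under [RHS]eq_bigr do rewrite mulrDr; rewrite big_split/= -mulr_suml p1 mul1r.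
rewrite -sumEFin; apply: lee_sum => i _.
have [->|pi0] := eqVneq (p i) 0; first by rewrite mul0e mul0r.
rewrite EFinM lee_pmul2l//; last by rewrite lte_fin lt_neqAle eq_sym pi0 p0.
have -> : ((C i + e)%:E = \int[rho i]_x cst (C i + e)%:E x)%E.
  rewrite integral_cst// -[LHS]mule1; congr (_ * _)%E; apply/esym.
  exact: probability_setT.
apply: ae_ge0_le_integral => //.
- by move=> x _; rewrite lee_fin.
- by move=> x _; rewrite lee_fin.
have [S [mS S0 sub]] := (rhoP i pi0).2; exists S; split => // x /= h; apply: sub => xi.
by apply: h => _; rewrite lee_fin; exact: cC.
Qed.

End cells.

Lemma strong_duality (k0 : 'I_K) (D e : R) :
  (forall h, admissible c mu h -> (J mu h <= D%:E)%E) -> 0 < e ->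
  exists2 pi, couplings mu pi & (\int[pi]_x (c x)%:E <= (D + e)%:E)%E.
Proof.
move=> dual e0; have e20 : 0 < e / 2 by rewrite divr_gt0.
have [r r0 rP] := box_unif_continuous compactX c_cont e20.
have [N [q [mq qP]]] := borel_cells compactX r0.
pose I : finType := {ffun 'I_K -> 'I_N.+1}.
pose cell (i : I) : set (prodX X) := [set z | forall k, q k (z k) = i k].
(* On an empty cell this is the default [c point], of which only nonnegativity matters. *)
pose C i := c (xget point (cell i)).
have CP i z : cell i z -> `|c z - C i| <= e / 2.
  move=> zi; apply: rP => k; apply: qP; rewrite zi.
  by have /(xgetPex point)/(_ k)-> : exists z, cell i z by exists z.
pose A (i : I) (kj : 'I_K * 'I_N.+1) : R := (i kj.1 == kj.2)%:R.
pose b (kj : 'I_K * 'I_N.+1) : R := fine (mu kj.1 [set x | q kj.1 x = kj.2]).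
have K0 : K%:R != 0 :> R by rewrite pnatr_eq0 -lt0n (leq_ltn_trans _ (ltn_ord k0)).
(* The error [e] is split in two: one half for comparing the finite dual with the original one, one
   half for spreading [p] over the cells. *)
have [||p [p0 p1 pb pC]] := @finite_duality R I _ A b C (D + e / 2) [ffun=> ord0].
- by move=> i; exact: c_ge0.
- move=> y t yC.
  (* The multiplier [t] is shared equally among the [K] components; subtracting [e / 2] in total
     makes the step functions satisfy [csub], as [c] is at least [C i - e / 2] on the cell [i]. *)
  pose g k j : R := y (k, j) + (t - e / 2) / K%:R.
  have bsum k : \sum_j b (k, j) = 1.
    have := @measure_fibers R _ (borel (X k)) (mu k) _ (q k) (mq k) setT measurableT.
    rewrite (eq_bigr (fun j => (b (k, j))%:E)) => [|j _].
      rewrite sumEFin => /(congr1 fine)/= <-.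
      by rewrite (_ : mu k _ = 1%E)//; exact: (@probability_setT _ (borel (X k)) R (mu k)).
    by rewrite setTI /b fineK// fin_num_measure//; exact: mq.
  have Ksum : \sum_(k < K) (t - e / 2) / K%:R = t - e / 2.
    by rewrite sumr_const card_ord -[LHS]mulr_natl mulrCA divff// mulr1.
  have gsum : \sum_k \sum_j g k j * b (k, j) = \sum_kj y kj * b kj + (t - e / 2).
    have -> : \sum_kj y kj * b kj = \sum_k \sum_j y (k, j) * b (k, j).
      by rewrite pair_bigA; apply: eq_bigr => -[].
    rewrite -Ksum -big_split/=; apply: eq_bigr => k _.
    transitivity (\sum_j y (k, j) * b (k, j) + (t - e / 2) / K%:R * \sum_j b (k, j)).
      by rewrite mulr_sumr -big_split; apply: eq_bigr => j _; exact: mulrDl.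
    by rewrite bsum mulr1.
  suff : \sum_k \sum_j g k j * b (k, j) <= D by rewrite gsum; lra.
  apply: (@step_csub_J _ q mq g D dual) => z.
  pose i : I := [ffun k => q k (z k)].
  have zi : cell i z by move=> k; rewrite ffunE.
  have := yC i; have := CP i z zi; rewrite ler_norml => /andP[? ?].
  have -> : \sum_kj y kj * A i kj = \sum_k y (k, q k (z k)).
    transitivity (\sum_k \sum_j y (k, j) * A i (k, j)).
      by rewrite pair_bigA; apply: eq_bigr => -[].
    apply: eq_bigr => k _; rewrite (bigD1 (q k (z k)))//= /A /= ffunE eqxx mulr1.
    by rewrite big1 ?addr0// => j /negbTE jq; rewrite eq_sym jq mulr0.
  by rewrite /g big_split/= Ksum; lra.
have [k j|pi piP pic] := @cell_plan _ q mq p p0 p1.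
  exact: (pb (k, j)).
exists pi => //; apply: (le_trans (pic (e / 2) C _ _)).
  by move=> i; apply: addr_ge0; [exact: c_ge0|exact: ltW].
  by move=> i z /CP; rewrite ler_norml => /andP[]; lra.
by rewrite lee_fin; lra.
Qed.

End strong_duality.

Theorem theorem3 (R : realType) (K : nat) (hK : (3 <= K)%N)
    (X : 'I_K -> pmetricType R)
    (hX : forall k, compact [set: X k])
    (mu : forall k, probability (borel (X k)) R)
    (c : prodX X -> R) (hc0 : forall x, 0 <= c x) (hc : continuous c) :
  (exists f : forall k, X k -> R,
     [/\ admissible c mu f,
         forall g, admissible c mu g -> (J mu g <= J mu f)%E &
         forall k, cconj c (f k)]) /\
  is_max (J mu @` admissible c mu) (MOT c mu) /\
  is_max (J mu @` (admissible c mu `&` cconj_family c)) (MOT c mu).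
Proof.
pose k0 : 'I_K := Ordinal (ltnW (ltnW hK)).
have [f [fa fcc fmax]] := dual_maximizer hX mu hc hc0 k0.
have JfE : J mu f = (fine (J mu f))%:E.
  by rewrite fineK//; apply: J_fin_num => k; have [_] := fa.
have MOTE : MOT c mu = J mu f.
  apply/eqP; rewrite eq_le; apply/andP; split; last first.
    by apply: le_ereal_inf_tmp => _ [pi piP <-]; exact: J_le_cost.
  (* Plans of cost at most [J mu f + e] for every [e > 0] bound the infimum, attained or not. *)
  apply/lee_addgt0Pr => e e0.
  have dual g : admissible c mu g -> (J mu g <= (fine (J mu f))%:E)%E.
    by rewrite -JfE; exact: fmax.
  have [pi piP pie] := strong_duality hX hc hc0 k0 dual e0.
  apply: (@le_trans _ _ (\int[pi]_x (c x)%:E)%E); last by rewrite JfE.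
  by apply: ereal_inf_lbound; exists pi.
rewrite MOTE; split; first by exists f.
split; split.
- by exists f.
- by move=> _ [g ga <-]; exact: fmax.
- by exists f.
- by move=> _ [g [ga _] <-]; exact: fmax.
Qed.
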